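(* Let $\boldsymbol{\theta}=(\theta^{(n)})_{n\ge0}$ and $\boldsymbol{\tau}=(\tau^{(n)})_{n\ge0}$ be two torsion-free constant-length directive sequences, each defined on a sequence of alphabets of bounded size, with length sequences $(q_n)_{n\ge0}$ and $(\tilde q_n)_{n\ge0}$ respectively. If there is a prime factor of some $q\in\{q_n:n\ge0\}$ that is not a prime factor of any $\tilde q\in\{\tilde q_n:n\ge0\}$, then $(X_{\boldsymbol\theta},\sigma)$ cannot be a topological factor of $(X_{\boldsymbol\tau},\sigma)$.
   Context: Alphabets are finite sets. A morphism $\theta:\mathcal A\to\mathcal B^+$ maps letters to non-empty words and is extended by concatenation to words and to $\mathcal A^{\mathbb Z}$. $\sigma$ is the left shift. A directive sequence is a sequence $\boldsymbol\theta=(\theta^{(n)})_{n\ge 0}$ of morphisms $\theta^{(n)}:\mathcal A_{n+1}\to\mathcal A_n^+$; the alphabets are of bounded size if $\sup_n|\mathcal A_n|<\infty$. Put $\theta^{[n,N)}=\theta^{(n)}\circ\cdots\circ\theta^{(N-1)}$. $X^{(n)}_{\boldsymbol\theta}$ is the set of $x\in\mathcal A_n^{\mathbb Z}$ all of whose finite subwords are subwords of $\theta^{[n,N)}(a)$ for some $N>n$ and $a\in\mathcal A_N$; $X_{\boldsymbol\theta}=X^{(0)}_{\boldsymbol\theta}$. $\boldsymbol\theta$ is constant-length with length sequence $(q_n)$ if $|\theta^{(n)}(a)|=q_n$ for all $n$ and all $a\in\mathcal A_{n+1}$. $\boldsymbol\theta$ is torsion-free if it is constant-length with length sequence $(q_n)$,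 $q_n>1$ for infinitely many $n$, each $(X^{(n)}_{\boldsymbol\theta},\sigma)$ is minimal, $X^{(0)}_{\boldsymbol\theta}$ is aperiodic (contains no $\sigma$-periodic point), and every prime dividing some $q_k$ divides $q_n$ for infinitely many $n$. $(Y,S)$ is a topological factor of $(X,T)$ if there is a continuous surjection $X\to Y$ commuting with the dynamics. *)

(* Defs.v *)
From mathcomp Require Import all_boot all_order all_algebra.
From mathcomp Require Import all_classical topology.

Set Implicit Arguments.
Unset Strict Implicit.
Unset Printing Implicit Defensive.

Import Order.TTheory GRing.Theory Num.Theory.

Local Open Scope ring_scope.
Local Open Scope classical_set_scope.

Definition minimal (T : topologicalType) (X : set T) (S : T -> T) : Prop :=
  [/\ X !=set0, closed X, S @` X = X &
      forall Y : set T, Y `<=` X -> Y !=set0 -> closed Y -> S @` Y = Y ->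
        Y = X].

Definition aperiodic (T : Type) (X : set T) (S : T -> T) : Prop :=
  forall (x : T) (p : nat), X x -> (0 < p)%N -> iter p S x <> x.

(* [pi] is a total map on the ambient space, but only its values on [X] are
   constrained, continuity being relative to the subspace topology of [X]. *)
Definition topological_factor (T U : topologicalType)
    (Y : set U) (SY : U -> U) (X : set T) (SX : T -> T) : Prop :=
  exists pi : T -> U,
    [/\ {within X, continuous pi}, pi @` X = Y &
        forall x, X x -> pi (SX x) = SY (pi x)].

Definition biseq (A : finType) : topologicalType :=
  {ptws int -> discrete_topology A}.

Definition left_shift (A : finType) (x : biseq A) : biseq A :=
  fun i => x (i + 1).

Definition window (A : finType) (x : biseq A) (i : int) (l : nat) : seq A :=
  [seq (x (i + j%:Z) : A) | j <- iota 0 l].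

Record directive_sequence := DirectiveSequence {
  alphabet : nat -> finType;
  morph : forall n, alphabet n.+1 -> seq (alphabet n);
  morph_nonempty : forall n (a : alphabet n.+1), morph a <> [::]
}.

Definition bounded_alphabets (theta : directive_sequence) : Prop :=
  exists C : nat, forall n, (#|alphabet theta n| <= C)%N.

(* [compose theta n k] is the composition of the k morphisms of levels
   n, ..., n + k - 1; its source alphabet is indexed by [k + n] rather than
   [n + k] so that the recursion typechecks by conversion. *)
Fixpoint compose (theta : directive_sequence) (n k : nat) :
    alphabet theta (k + n)%N -> seq (alphabet theta n) :=
  match k return alphabet theta (k + n)%N -> seq (alphabet theta n) with
  | 0 => fun a => [:: a]
  | k'.+1 => fun a =>
      flatten [seq @compose theta n k' b | b <- @morph theta (k' + n)%N a]
  end.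

Arguments compose : clear implicits.

Definition level_shift (theta : directive_sequence) (n : nat) :
    set (biseq (alphabet theta n)) :=
  [set x | forall (i : int) (l : nat),
     exists (k : nat) (a : alphabet theta (k + n)%N),
       (0 < k)%N /\ infix (window x i l) (compose theta n k a)].

Arguments level_shift : clear implicits.

Definition constant_length (theta : directive_sequence) (q : nat -> nat) :
    Prop :=
  forall n (a : alphabet theta n.+1), size (morph a) = q n.

Definition torsion_free (theta : directive_sequence) (q : nat -> nat) : Prop :=
  [/\ constant_length theta q,
      (forall N, exists n, (N <= n)%N /\ (1 < q n)%N),
      (forall n, minimal (level_shift theta n)
                         (@left_shift (alphabet theta n))),
      aperiodic (level_shift theta 0) (@left_shift (alphabet theta 0)) &
      forall p k, prime p -> (p %| q k)%N ->
        forall N, exists n, (N <= n)%N /\ (p %| q n)%N].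

(* Main.v *)
Require Import Defs.
From mathcomp Require Import all_boot all_order all_algebra.
From mathcomp Require Import all_classical topology.
From mathcomp Require Import zify.

(** Let [P = q 0 * ... * q (n-1)] and let [Y] be the image of the level-[n]
    shift of [theta] under the composed substitution. Then [Y] is minimal for
    the [P]-th power of the shift, so the [j] such that the [j]-th shift of [Y]
    meets [Y] form a group generated by a divisor [c] of [P], and the shifts of
    [Y] partition the level-0 shift into [c] clopen sets. If [P / c] were at
    least the size of the level-[n] alphabet, a point of [Y], read in blocks of
    length [c], would have at most [P / c] words of length [P / c] and thus be
    periodic, by Morse and Hedlund. Hence [P / c] is bounded, and for [n] large
    [c] is divisible by any given power [p ^ K].

    A factor map pulls this back to a cyclic clopen partition of the level-0
    shift of [tau] whose period is a multiple of [p ^ K]. If [H] is a product of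
    the first lengths of [tau] that exceeds twice a radius determining the class
    of a point, the class of a point in the middle of a substituted block of
    length [H] depends only on the letter substituted. As the class advances by
    [H] from a letter to the next and [H] is prime to [p], the alphabet has at
    least [p ^ K] letters, for every [K]. *)

Set Implicit Arguments.
Unset Strict Implicit.
Unset Printing Implicit Defensive.

Import Order.TTheory GRing.Theory Num.Theory.

Local Open Scope ring_scope.
Local Open Scope classical_set_scope.

(** * Words of a coded sequence and periodicity, after Morse and Hedlund *)

Section MorseHedlund.
Variables (T : Type) (F : finType) (u : int -> T) (d : nat) (g : int -> F).
Hypothesis codeP : forall t t', g t = g t' ->
  forall j, (j < d)%N -> u (t + j%:Z) = u (t' + j%:Z).

Let same l (t t' : int) := forall j, (j < l)%N -> u (t + j%:Z) = u (t' + j%:Z).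

Let same_sym l t t' : same l t t' -> same l t' t.
Proof. by move=> h j /h. Qed.

Let same_trans l t1 t2 t3 : same l t1 t2 -> same l t2 t3 -> same l t1 t3.
Proof. by move=> h1 h2 j jl; rewrite h1 ?h2. Qed.

Let same_le k l t t' : (k <= l)%N -> same l t t' -> same k t t'.
Proof. by move=> kl h j jk; apply: h; apply: leq_trans kl. Qed.

Let separated l (s : seq int) :=
  forall i j, (i < size s)%N -> (j < size s)%N ->
    same l (nth 0 s i) (nth 0 s j) -> i = j.

Let separated_cons l s t : separated l s ->
  (forall i, (i < size s)%N -> ~ same l t (nth 0 s i)) -> separated l (t :: s).
Proof.
move=> sep new [|i] [|j] //= si sj.
- by move=> h; case: (new j).
- by move=> h; case: (new i) => //; exact: same_sym.
- by move=> /sep ->.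
Qed.

(* The number of words of length [l] grows strictly with [l] until it
   stabilizes. *)
Let stable_or_separated l : (l <= d)%N ->
  (exists2 k, (k < l)%N & forall t t', same k t t' -> same k.+1 t t') \/
  (exists2 s, size s = l.+1 & separated l s).
Proof.
elim: l => [_|l IHl ld]; first by right; exists [:: 0] => //; case=> [|i] [|j].
have [[k kl kst]|[s ss sep]] := IHl (ltnW ld).
  by left; exists k => //; exact: ltnW.
have [st|] := pselect (forall t t', same l t t' -> same l.+1 t t').
  by left; exists l.
move=> /existsNP[t] /existsNP[t'] /not_implyP[tt' ntt']; right.
have sep' : separated l.+1 s.
  by move=> i j si sj /(same_le (leqnSn l)); exact: sep.
have [|/existsNP[i] /not_implyP[si /contrapT ti]] :=
    pselect (forall i, (i < size s)%N -> ~ same l.+1 t (nth 0 s i)).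
  by exists (t :: s); [rewrite /= ss|exact: separated_cons].
(* At length [l] at most one member of [s] carries the common word of [t] and [t']. That member
   continues like [t], hence not like [t'], so [t'] is new. *)
exists (t' :: s); first by rewrite /= ss.
apply: separated_cons => // j sj tj; apply: ntt'.
have eij : i = j.
  apply: sep => //; apply: same_trans (same_le (leqnSn l) tj).
  by apply: same_trans tt'; apply: same_sym; exact: same_le (leqnSn l) ti.
by move: tj; rewrite -eij => /same_sym; exact: same_trans.
Qed.

(** Separated positions at length [d] would need [d + 1] distinct codes, so some length [k < d] is
    stable: a word of length [k] determines all later letters. A repeated code thus gives a period
    from there on, of size at most [#|F|]; the factorial is a multiple of all such periods and does
    not depend on [t]. *)
Lemma coded_windows_periodic : (#|F| <= d)%N ->
  exists2 m, (0 < m)%N & forall t, u (t + m%:Z) = u t.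
Proof.
move=> Fd.
have [k kd st] : exists2 k, (k < d)%N &
    forall t t', same k t t' -> same k.+1 t t'.
  have [//|[s ss sep]] := stable_or_separated (leqnn d).
  have inj : injective (fun i : 'I_d.+1 => g (nth 0 s i)).
    move=> i j /codeP h; apply/val_inj.
    by apply: (sep i j) => //; rewrite ss.
  have := leq_card _ inj; rewrite card_ord => dF.
  by have := leq_trans dF Fd; rewrite ltnn.
have same_shift n t t' : same k t t' -> same k.+1 (t + n%:Z) (t' + n%:Z).
  elim: n => [|n IHn] h; first by rewrite !addr0; exact: st.
  apply: st => j jk; have := IHn h j.+1 jk.
  by rewrite -!addrA -!PoszD addSnnS.
exists (#|F|)`!; first exact: fact_gt0.
move=> t.
(* The [#|F| + 1] positions tried end at [t], so that propagating the coincidence forward reaches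
   [t]. *)
have /injectivePn[i [j ij gij]] :
    ~~ injectiveb (fun i : 'I_#|F|.+1 => g (t - #|F|%:Z + i%:Z)).
  apply/negP => /injectiveP /leq_card; rewrite card_ord.
  by rewrite ltnn.
wlog {ij} ij : i j gij / (i < j)%N.
  move=> wl; have [/wl->//|/wl->//|/val_inj e] := ltngtP i j.
  by rewrite e eqxx in ij.
have per n : u (t + n%:Z + (j - i)%N%:Z) = u (t + n%:Z).
  have sk : same k (t - #|F|%:Z + i%:Z) (t - #|F|%:Z + j%:Z).
    by move=> l lk; apply: (codeP gij); exact: ltn_trans kd.
  have := same_shift (#|F| - i + n)%N _ _ sk 0 erefl.
  have := ltn_ord i => iF; rewrite !addr0 => e.
  by transitivity (u (t - #|F|%:Z + j%:Z + (#|F| - i + n)%N%:Z));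
    [|rewrite -e]; congr u; lia.
have per_mul n : u (t + ((j - i) * n)%N%:Z) = u t.
  elim: n => [|n IHn]; first by rewrite muln0 addr0.
  by rewrite -[RHS]IHn -[RHS]per mulnS addnC PoszD addrA.
have /dvdnP[n ->] : (j - i %| (#|F|)`!)%N.
  by apply: dvdn_fact; have := ltn_ord j; lia.
by rewrite mulnC; exact: per_mul.
Qed.

End MorseHedlund.

(** * Two-sided sequences: shifts, windows and topology *)

Section Biseq.
Variable A : finType.
Implicit Types (x y : biseq A) (i k : int) (r l : nat).

Definition shiftz k x : biseq A := fun i => x (i + k).

Lemma shiftz0 x : shiftz 0 x = x.
Proof. by apply: funext => i; rewrite /shiftz addr0. Qed.

Lemma shiftzD i k x : shiftz i (shiftz k x) = shiftz (i + k) x.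
Proof. by apply: funext => j; rewrite /shiftz addrA. Qed.

Lemma shiftzK k : cancel (shiftz k) (shiftz (- k)).
Proof. by move=> x; rewrite shiftzD addNr shiftz0. Qed.

Lemma shiftzNK k : cancel (shiftz (- k)) (shiftz k).
Proof. by move=> x; rewrite shiftzD addrN shiftz0. Qed.

Lemma iter_left_shift n x : iter n (@left_shift A) x = shiftz n%:Z x.
Proof.
elim: n => [|n IHn]; first by rewrite shiftz0.
rewrite iterS IHn; apply: funext => i.
by rewrite /left_shift /shiftz -addrA -PoszD add1n.
Qed.

Lemma size_window x i l : size (window x i l) = l.
Proof. by rewrite size_map size_iota. Qed.

Lemma nth_window a x i l j : (j < l)%N -> nth a (window x i l) j = x (i + j%:Z).
Proof. by move=> jl; rewrite (nth_map 0%N) ?size_iota // nth_iota. Qed.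

Lemma window_cat x i l l' :
  window x i (l + l') = window x i l ++ window x (i + l%:Z) l'.
Proof.
rewrite /window iotaD map_cat add0n; congr cat.
rewrite -[in LHS](addn0 l) iotaDl -map_comp; apply: eq_map => j /=.
by rewrite PoszD addrA.
Qed.

Lemma infix_window x i l k m : k <= i -> i + l%:Z <= k + m%:Z ->
  infix (window x i l) (window x k m).
Proof.
move=> ki ilkm.
have [a ei] : exists a : nat, i = k + a%:Z by exists `|(i - k)%R|%N; lia.
have [b ->] : exists b : nat, m = (a + (l + b))%N.
  by exists (m - a - l)%N; lia.
rewrite ei !window_cat; apply/infixP.
by exists (window x k a), (window x (k + a%:Z + l%:Z) b).
Qed.

Definition agree r x y := forall i, (`|i| <= r)%N -> x i = y i.

Lemma agree_le r r' x y : (r <= r')%N -> agree r' x y -> agree r x y.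
Proof. by move=> rr' h i /leq_trans/(_ rr'); exact: h. Qed.

Lemma near_coord x i : \forall y \near x, y i = x i.
Proof.
have /(_ [set x i]) := @proj_continuous int (fun=> discrete_topology A) i x.
by apply; exact: discrete_set1.
Qed.

Lemma near_agree x r : \forall y \near x, agree r x y.
Proof.
have : \forall y \near x, forall i, i \in map Posz (iota 0 r.+1) ++
    map (fun n => - n%:Z) (iota 0 r.+1) -> y i = x i.
  elim: (_ ++ _) => [|i s IHs]; first by near=> y.
  near=> y => j; rewrite inE => /orP[/eqP->|].
    by near: y; exact: near_coord.
  by move: j; near: y.
apply: filterS => y h i ir; rewrite h // mem_cat; apply/orP.
case: (leP 0 i) => i0; [left|right]; apply/mapP; exists `|i|%N;
  rewrite ?mem_iota /=; lia.
Unshelve. all: by end_near. Qed.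

(** The product topology is a supremum over coordinates, and each coordinate is fixed by agreement
    on a large enough radius; hence the filter [G] converges to [x]. *)
Lemma nbhs_agree x (U : set (biseq A)) : nbhs x U ->
  exists r, forall y, agree r x y -> U y.
Proof.
pose G := filter_from setT (fun r => [set y | agree r x y]).
have GF : Filter G.
  apply: filter_from_filter; first by exists 0%N.
  move=> r r' _ _; exists (maxn r r') => // y h; split; apply: agree_le h.
    exact: leq_maxl.
  exact: leq_maxr.
suff : G --> x by move=> Gx /Gx [r _ h]; exists r.
apply/cvg_sup => i; apply/cvg_image.
  by rewrite eqEsubset; split=> v // _; exists (fun=> v).
move=> U' /= /(nbhs_singleton (A := U')) U'x.
exists ((fun y => y i) @^-1` U').
  by exists `|i|%N => // y h /=; rewrite -h.
by rewrite eqEsubset; split => [? [? ? <-]//|v]; exists (fun=> v).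
Qed.

Lemma continuous_coord (T : topologicalType) (f : T -> biseq A) :
  (forall t i, \forall t' \near t, f t' i = f t i) -> continuous f.
Proof.
move=> h t; apply/cvg_sup => i; apply/cvg_image.
  by rewrite eqEsubset; split=> v // _; exists (fun=> v).
move=> U /= /(nbhs_singleton (A := U)) Ux.
exists ((fun y => y i) @^-1` U).
  by apply: filterS (h t i) => t' /= ->.
by rewrite eqEsubset; split => [? [? ? <-]//|v]; exists (fun=> v).
Qed.

Lemma continuous_shiftz k : continuous (shiftz k).
Proof. by apply: continuous_coord => x i; exact: near_coord. Qed.

Lemma closed_shiftz k (Y : set (biseq A)) :
  closed Y -> closed [set x | Y (shiftz k x)].
Proof. by move: Y; apply/continuous_closedP; exact: continuous_shiftz. Qed.

Lemma compact_biseq : compact [set: biseq A].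
Proof.
have := @tychonoff int (fun=> discrete_topology A) (fun=> setT).
rewrite (_ : [set f | _] = setT); first last.
  by apply/seteqP; split.
by apply=> _; apply: finite_compact; exact: (@finite_finset A).
Qed.

Lemma closed_compact_biseq (Y : set (biseq A)) : closed Y -> compact Y.
Proof. by move=> Yc; apply: subclosed_compact compact_biseq _. Qed.

Lemma compact_closed_biseq (Y : set (biseq A)) : compact Y -> closed Y.
Proof.
apply: compact_closed.
by apply: (@hausdorff_product int (fun=> discrete_topology A)) => _;
  exact: discrete_hausdorff.
Qed.

(** Compactness makes the pointwise radius uniform: two points that agree far enough, one of them
    near a centre [x], are compared through [x], which is where symmetry and transitivity of [E]
    enter. *)
Lemma uniform_radius (X : set (biseq A)) (E : biseq A -> biseq A -> Prop) :
  closed X -> (forall x y, E x y -> E y x) ->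
  (forall x y z, E x y -> E y z -> E x z) ->
  (forall x, X x -> exists r, forall y, X y -> agree r x y -> E x y) ->
  exists r, forall x y, X x -> X y -> agree r x y -> E x y.
Proof.
move=> /closed_compact_biseq/compact_near_coveringP/near_covering_withinP Xc.
move=> Esym Etrans Eloc.
have [|r _ h] := Xc nat \oo
    (fun r x => forall y, X y -> agree r x y -> E x y) _.
  move=> x /Eloc[r xr]; near=> y r' => /= Xy z Xz yz.
  have xy : agree r x y by near: y; exact: near_agree.
  have rr' : (r <= r')%N by near: r'; exact: nbhs_infty_ge.
  apply: Etrans (Esym _ _ (xr _ Xy xy)) (xr _ Xz _) => i ir.
  by rewrite xy // yz //; apply: leq_trans rr'.
by exists r => x y Xx; apply: h => //=.
Unshelve. all: by end_near. Qed.

End Biseq.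

(** * Constant-length substitutions on two-sided sequences *)

Section Substitution.
Variables (A B : finType) (P : nat) (b0 : B) (e : A -> seq B).
Hypotheses (P_gt0 : (0 < P)%N) (size_e : forall a, size (e a) = P).

(** Division with non-negative remainder places the block of [y n] at [n * P] for negative [n] too.
    The default [b0] is never reached when all images have length [P]. *)
Definition subst (y : biseq A) : biseq B :=
  fun i => nth b0 (e (y (i %/ P%:Z)%Z)) `|(i %% P%:Z)%Z|.

Lemma substE y (n : int) (j : nat) : (j < P)%N ->
  subst y (n * P%:Z + j%:Z) = nth b0 (e (y n)) j.
Proof.
move=> jP; rewrite /subst divzMDl; last by lia.
by rewrite modzMDl divz_small ?modz_small ?addr0 //; lia.
Qed.

Lemma shiftz_subst k y :
  shiftz (k * P%:Z) (subst y) = subst (shiftz k y).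
Proof.
apply: funext => i; rewrite /shiftz /subst addrC divzMDl; last by lia.
by rewrite modzMDl addrC.
Qed.

Lemma window_subst1 y k : window (subst y) (k * P%:Z) P = e (y k).
Proof.
apply: (@eq_from_nth _ b0); first by rewrite size_window size_e.
by move=> j; rewrite size_window => jP; rewrite nth_window // substE.
Qed.

Lemma window_subst y k m :
  window (subst y) (k * P%:Z) (m * P) = flatten [seq e a | a <- window y k m].
Proof.
elim: m k => [|m IHm] k //.
rewrite mulSn -[m.+1]add1n !window_cat map_cat flatten_cat /= cats0 addr0.
by rewrite window_subst1 -IHm; congr (_ ++ window _ _ _); rewrite mulrDl mul1r.
Qed.

(** The window starts at an offset below [P] in its first block, and [P + l <= P * l.+1]. *)
Lemma infix_window_subst y i l :
  infix (window (subst y) i l)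
        (flatten [seq e a | a <- window y (i %/ P%:Z)%Z l.+1]).
Proof.
rewrite -window_subst; have P0 : P%:Z != 0 by lia.
have iP : 0 <= (i %% P%:Z)%Z < P%:Z.
  by rewrite modz_ge0 //= ltz_pmod //; lia.
rewrite {1}(divz_eq i P%:Z); apply: infix_window; first by lia.
by rewrite mulSn PoszD PoszM; nia.
Qed.

Lemma continuous_subst : continuous subst.
Proof.
apply: continuous_coord => y i; apply: filterS (near_coord y (i %/ P%:Z)%Z).
by move=> z zy; rewrite /subst zy.
Qed.

End Substitution.

Lemma infix_flatten_map (A B : eqType) (f : A -> seq B) (s t : seq A) :
  infix s t -> infix (flatten (map f s)) (flatten (map f t)).
Proof.
case/infixP=> s1 [s2 ->]; rewrite !map_cat !flatten_cat.
exact: infix_infix.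
Qed.

(** * Composed substitutions along a directive sequence *)

Section Tower.
Variable theta : directive_sequence.
Local Notation X := (level_shift theta).

(* [expand n] is [compose theta 0 n] without the index [n + 0]. *)
Fixpoint expand n : alphabet theta n -> seq (alphabet theta 0) :=
  match n return alphabet theta n -> seq (alphabet theta 0) with
  | 0 => fun a => [:: a]
  | n'.+1 => fun a => flatten [seq expand b | b <- morph a]
  end.

Lemma expand_compose n k (a : alphabet theta (k + n)%N) :
  flatten [seq expand b | b <- compose theta n k a] = expand a.
Proof.
elim: k a => [|k IHk] a /=; first by rewrite cats0.
elim: (morph a) => //= b s IHs.
by rewrite map_cat flatten_cat IHs IHk.
Qed.

Lemma compose0E k (a : alphabet theta (k + 0)%N) :
  compose theta 0 k a = expand a.
Proof.
rewrite -expand_compose; elim: (compose _ _ _ a) => //= b s <-.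
by [].
Qed.

(** Indices such as [k + n] and [k + n + 0] are not convertible, so letters are transported along an
    equality. *)
Lemma expand_cast m n (a : alphabet theta m) : m = n ->
  exists b : alphabet theta n, expand b = expand a.
Proof. by move=> <-; exists a. Qed.

Variable q : nat -> nat.
Hypothesis cl : constant_length theta q.

Definition height n := (\prod_(i < n) q i)%N.

Lemma size_expand n (a : alphabet theta n) : size (expand a) = height n.
Proof.
rewrite /height; elim: n a => [|n IHn] a /=; first by rewrite big_ord0.
rewrite big_ord_recr /= -(cl a) mulnC.
by elim: (morph a) => //= b s IHs; rewrite size_cat IHs IHn mulSn.
Qed.

Lemma subst_level n a0 y : (0 < height n)%N -> X n y ->
  X 0%N (subst (height n) a0 (@expand n) y).
Proof.
move=> hn0 yX i l.
have [k [a [k0 ya]]] := yX (i %/ (height n)%:Z)%Z l.+1.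
have [b eb] := expand_cast a (esym (addn0 (k + n)%N)).
exists (k + n)%N, b; split; first by lia.
rewrite compose0E eb -expand_compose.
apply: infix_trans (infix_flatten_map _ ya).
by apply: infix_window_subst => //; exact: size_expand.
Qed.

End Tower.

Lemma level_shiftz theta n k x :
  level_shift theta n x -> level_shift theta n (shiftz k x).
Proof.
move=> xX i l; have [m [a ?]] := xX (i + k) l; exists m, a.
rewrite (_ : window (shiftz k x) i l = window x (i + k) l) //.
by apply: eq_map => j; rewrite /shiftz addrAC.
Qed.

(** * Return times to the image of a level shift *)

Section ReturnTimes.
Variables (theta : directive_sequence) (q : nat -> nat).
Hypothesis tf : torsion_free theta q.
Local Notation X := (level_shift theta).

Let cl : constant_length theta q. Proof. by case: tf. Qed.

Let minimalX n : minimal (X n) (@left_shift (alphabet theta n)).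
Proof. by case: tf. Qed.

Lemma length_gt0 n : (0 < q n)%N.
Proof.
have [[x _] _ _ _] := minimalX n.+1.
by rewrite -(cl (x 0)) lt0n size_eq0; apply/eqP; exact: morph_nonempty.
Qed.

Lemma height_gt0 n : (0 < height q n)%N.
Proof. by apply: prodn_gt0 => i; exact: length_gt0. Qed.

Variables (n : nat) (a0 : alphabet theta 0).
Local Notation P := (height q n).

Definition base : set (biseq (alphabet theta 0)) :=
  subst P a0 (@expand theta n) @` X n.

Let return_time (j : int) := exists2 z, base z & base (shiftz j z).

Lemma base_nonempty : base !=set0.
Proof. by have [[y Xy] _ _ _] := minimalX n; eexists; exists y. Qed.

Lemma base_closed : closed base.
Proof.
have [_ Xc _ _] := minimalX n.
apply: compact_closed_biseq; apply: continuous_compact.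
  exact/continuous_subspaceT/continuous_subst.
exact: closed_compact_biseq.
Qed.

Lemma base_sub x : base x -> X 0%N x.
Proof.
by case=> y Xy <-; apply: (subst_level (q := q)) => //; exact: height_gt0.
Qed.

Lemma base_shift k x : base x -> base (shiftz (k * P%:Z) x).
Proof.
case=> y Xy <-; exists (shiftz k y); first exact: level_shiftz.
by rewrite shiftz_subst //; exact: height_gt0.
Qed.

Lemma base_shiftE k x : base (shiftz (k * P%:Z) x) <-> base x.
Proof.
split; last exact: base_shift.
by move=> /(base_shift (- k)); rewrite mulNr shiftzK.
Qed.

(** The substitution intertwines the shift with its [P]-th power, so the preimage of [Z] in [X n] is
    closed, shift-invariant and non-empty; minimality of [X n] applies. *)
Lemma base_minimal (Z : set (biseq (alphabet theta 0))) :
  closed Z -> base `&` Z !=set0 ->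
  (forall k x, Z x -> Z (shiftz (k * P%:Z) x)) -> base `<=` Z.
Proof.
move=> Zc [_ [[y0 Xy0 <-] Zy0]] Zs.
have [_ Xc _ Xmin] := minimalX n.
pose f := subst P a0 (@expand theta n).
have Ws k y : (X n `&` f @^-1` Z) y -> (X n `&` f @^-1` Z) (shiftz k y).
  move=> [Xy Zy]; split; first exact: level_shiftz.
  rewrite /preimage /= /f -shiftz_subst; last exact: height_gt0.
  exact: Zs.
have WX : X n `&` f @^-1` Z = X n.
  apply: Xmin; first exact: subIsetl.
  - by exists y0.
  - apply: closedI => //; move: Z Zc {Zs Zy0 Ws}.
    by apply/continuous_closedP; exact: continuous_subst.
  - apply/seteqP; split=> [_ [y Wy <-]|y Wy]; first exact: (Ws 1).
    by exists (shiftz (-1) y); [exact: Ws|exact: (shiftzNK 1)].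
by move=> x [y]; rewrite -WX => -[_ Zy] <-.
Qed.

(** The condition [base (shiftz j x)] on [x] is closed and invariant under shifts by multiples of
    [P], so by [base_minimal] one point of [base] satisfying it forces all the others. *)
Lemma return_all j z z' :
  base z -> base (shiftz j z) -> base z' -> base (shiftz j z').
Proof.
move=> Yz Yjz; apply: (base_minimal (Z := [set x | base (shiftz j x)])).
- by apply: closed_shiftz; exact: base_closed.
- by exists z.
- by move=> k x /= /(base_shift k); rewrite !shiftzD addrC.
Qed.

Let return_sub i j : return_time i -> return_time j -> return_time (i - j).
Proof.
move=> [z Yz Yiz] [w Yw Yjw].
exists (shiftz j w) => //; rewrite shiftzD subrK.
exact: return_all Yiz Yw.
Qed.

Let return0 : return_time 0.
Proof. by have [z Yz] := base_nonempty; exists z; rewrite ?shiftz0. Qed.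

Let return_mul (k : int) j : return_time j -> return_time (k * j).
Proof.
have opp i : return_time i -> return_time (- i).
  by rewrite -sub0r; exact: return_sub.
move=> Rj; wlog k0 : k / 0 <= k.
  move=> wl; have [/wl//|k0] := leP 0 k.
  by rewrite -[k]opprK mulNr; apply/opp/wl; lia.
have [m ->] : exists m : nat, k = m%:Z by exists `|k|%N; lia.
elim: m => [|m IHm]; first by rewrite mul0r.
rewrite (_ : _ * j = m%:Z * j - (- j)).
  by apply: return_sub => //; exact: opp.
by rewrite opprK -addn1 PoszD mulrDl mul1r.
Qed.

(** Finitely many shifts of [base] have a closed union, which is shift-invariant since offsets may
    be reduced modulo [P]; minimality of [X 0] concludes. *)
Lemma base_cover x : X 0%N x -> exists2 i, (i < P)%N & base (shiftz i%:Z x).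
Proof.
have P0 := height_gt0 n.
have modP j y : base (shiftz j y) ->
    exists2 i, (i < P)%N & base (shiftz i%:Z y).
  move=> Yj; have jP : 0 <= (j %% P%:Z)%Z < P%:Z.
    by rewrite modz_ge0 ?ltz_pmod //=; lia.
  exists `|(j %% P%:Z)%Z|%N; first by lia.
  apply/(base_shiftE (j %/ P%:Z)%Z); rewrite shiftzD.
  by rewrite gez0_abs -?divz_eq //; case/andP: jP.
pose W := \bigcup_(i in `I_P) [set y | base (shiftz i%:Z y)].
have Ws k y : W y -> W (shiftz k y).
  move=> [i _ Yi]; have [|j jP Yj] := modP (i%:Z - k) (shiftz k y).
    by rewrite shiftzD subrK.
  by exists j.
have [_ _ _ Xmin] := minimalX 0.
suff <- : W = X 0%N by move=> [i iP Yi]; exists i.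
apply: Xmin.
- by move=> y [i _ /base_sub/(level_shiftz (- i%:Z))]; rewrite shiftzK.
- by have [z Yz] := base_nonempty; exists z; exists 0%N => //=; rewrite shiftz0.
- apply: closed_bigcup; first exact: finite_II.
  by move=> i _; apply: closed_shiftz; exact: base_closed.
- apply/seteqP; split=> [_ [y Wy <-]|y Wy]; first exact: (Ws 1).
  by exists (shiftz (-1) y); [exact: Ws|exact: (shiftzNK 1)].
Qed.

Lemma return_period : exists c : nat,
  [/\ (0 < c)%N, return_time c%:Z &
      forall j, return_time j -> (c%:Z %| j)%Z].
Proof.
have ex : exists j : nat, (0 < j)%N && `[< return_time j%:Z >].
  exists P; rewrite height_gt0; apply/asboolP.
  have [z Yz] := base_nonempty; exists z => //.
  by rewrite -[P%:Z]mul1r; exact: base_shift.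
case: (ex_minnP ex) => c /andP[c0 /asboolP Rc] cmin; exists c; split=> // j Rj.
have jc : 0 <= (j %% c%:Z)%Z < c%:Z by rewrite modz_ge0 ?ltz_pmod //=; lia.
have Rjc : return_time (j %% c%:Z)%Z.
  by apply: return_sub => //; exact: return_mul.
apply/dvdz_mod0P; apply/eqP; apply: contraT => jc0.
have := cmin `|(j %% c%:Z)%Z|%N; rewrite gez0_abs; last by case/andP: jc.
move=> /(_ _)/wrap[]; last by lia.
by apply/andP; split; [lia|apply/asboolP].
Qed.

Hypothesis ap : aperiodic (X 0%N) (@left_shift (alphabet theta 0)).

Lemma height_lt_period c d : (0 < c)%N -> return_time c%:Z ->
  height q n = (c * d)%N -> (d < #|alphabet theta n|)%N.
Proof.
move=> c0 Rc Pcd; rewrite ltnNge; apply/negP => Ad.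
have [y Yy] := base_nonempty.
have Yc (t : int) : base (shiftz (t * c%:Z) y).
  by have [z Yz Ytz] := return_mul t Rc; exact: return_all Ytz Yy.
(* The letter [z t 0] determines the [c * d] letters of [y] from [t * c] on, that is, [d]
   consecutive blocks of length [c]: it is the code for [coded_windows_periodic]. *)
have /choice[z zP] : forall t : int, exists w,
    subst P a0 (@expand theta n) w = shiftz (t * c%:Z) y.
  by move=> t; have [w _ <-] := Yc t; exists w.
have [|m m0 per] := @coded_windows_periodic _ (alphabet theta n)
    (fun t => window y (t * c%:Z) c) d (fun t => z t 0) _ Ad.
  move=> t t' ztt' j jd; apply/eq_in_map => i; rewrite mem_iota add0n /= => ic.
  have yE s : y ((s + j%:Z) * c%:Z + i%:Z) =
      nth a0 (expand (z s 0)) (j * c + i).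
    rewrite -(substE (P := P)); [|exact: height_gt0|by rewrite Pcd; nia].
    rewrite zP /shiftz; congr y.
    by rewrite mul0r add0r PoszD PoszM mulrDl -addrA addrC.
  by rewrite !yE ztt'.
apply: (ap (p := (m * c)%N) (base_sub Yy)); first by rewrite muln_gt0 m0.
rewrite iter_left_shift; apply: funext => i; rewrite /shiftz.
have ic : 0 <= (i %% c%:Z)%Z < c%:Z by rewrite modz_ge0 ?ltz_pmod //=; lia.
have := congr1 (fun s => nth a0 s `|(i %% c%:Z)%Z|%N) (per (i %/ c%:Z)%Z).
rewrite !nth_window; [|lia|lia]; rewrite gez0_abs; last by case/andP: ic.
rewrite -divz_eq => <-; congr y.
by rewrite {1}(divz_eq i c%:Z) mulrDl PoszM addrAC.
Qed.

End ReturnTimes.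

(** * Prime powers dividing heights and return periods *)

Lemma height_dvd q m n : (m <= n)%N -> (height q m %| height q n)%N.
Proof.
by move=> mn; rewrite /height -(subnKC mn) big_split_ord dvdn_mulr.
Qed.

Lemma prime_power_height theta q p K : torsion_free theta q -> prime p ->
  (exists k, (p %| q k)%N) -> exists n, (p ^ K %| height q n)%N.
Proof.
move=> [_ _ _ _ often] pp [k pqk].
elim: K => [|K [n IHn]]; first by exists 0%N; exact: dvd1n.
have [m [nm pqm]] := often p k pp pqk n.
exists m.+1; rewrite /height big_ord_recr /= expnSr dvdn_mul //.
exact: dvdn_trans IHn (height_dvd q nm).
Qed.

Lemma return_set theta q p K :
  torsion_free theta q -> bounded_alphabets theta -> prime p ->
  (exists k, (p %| q k)%N) ->
  exists (Y : set (biseq (alphabet theta 0))) (P : nat),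
    [/\ closed Y,
        forall x, level_shift theta 0 x ->
          exists2 i, (i < P)%N & Y (shiftz i%:Z x),
        forall j z z', Y z -> Y (shiftz j z) -> Y z' -> Y (shiftz j z') &
        forall j z, Y z -> Y (shiftz j z) -> ((p ^ K)%N%:Z %| j)%Z].
Proof.
move=> tf [C Cbd] pp pq.
(* The surplus [C] is what the cofactor [d] of the period [c] may absorb: the exponent of [p] in [d]
   is below [d], and [d < C]. *)
have [n pn] := prime_power_height (K + C) tf pp pq.
have [_ _ mini ap _] := tf.
have [[x0 _] _ _ _] := mini 0%N; pose a0 : alphabet theta 0 := x0 0.
have [c [c0 Rc cdiv]] := return_period tf n a0.
exists (base q n a0), (height q n); split.
- exact: base_closed tf _ _.
- exact: base_cover.
- exact: return_all.
move=> j z Yz Yjz; apply: dvdz_trans (cdiv j _); last by exists z.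
have [d Pcd] : exists d, height q n = (c * d)%N.
  have [z' Yz'] := base_nonempty tf n a0.
  have /cdiv : exists2 z,
      base q n a0 z & base q n a0 (shiftz (height q n)%:Z z).
    by exists z' => //; rewrite -[_%:Z]mul1r; exact: base_shift.
  by rewrite dvdzE !absz_nat => /dvdnP[d ->]; exists d; rewrite mulnC.
have dC : (d < C)%N.
  exact: leq_trans (height_lt_period tf ap c0 Rc Pcd) (Cbd n).
have P0 := height_gt0 tf n.
have d0 : (0 < d)%N by rewrite Pcd muln_gt0 in P0; case/andP: P0.
rewrite dvdzE !absz_nat pfactor_dvdn //; move: pn.
rewrite pfactor_dvdn // Pcd lognM // => Kcd.
have := ltn_logl p d0; lia.
Qed.

Lemma height_unbounded theta q M :
  torsion_free theta q -> exists n, (M < height q n)%N.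
Proof.
move=> tf; have [_ often _ _ _] := tf.
elim: M => [|M [n Mn]]; first by exists 0%N; exact: height_gt0 tf _.
have [m [nm qm]] := often n.
exists m.+1; rewrite /height big_ord_recr /= -/(height q m).
have := dvdn_leq (height_gt0 tf m) (height_dvd q nm); nia.
Qed.

(** * Transfer through the factor map and counting of letters *)

Lemma return_class_locally_constant (A B : finType) (Z : set (biseq B))
    (X Y : set (biseq A)) (P : nat) (pi : biseq B -> biseq A) :
  {within Z, continuous pi} -> pi @` Z `<=` X -> closed Y ->
  (forall x, X x -> exists2 i, (i < P)%N & Y (shiftz i%:Z x)) ->
  (forall k x, X x -> X (shiftz k x)) ->
  (forall j z z', Y z -> Y (shiftz j z) -> Y z' -> Y (shiftz j z')) ->
  forall x, Z x -> exists r, forall y, Z y -> agree r x y ->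
    forall i, Y (shiftz i (pi x)) <-> Y (shiftz i (pi y)).
Proof.
move=> /subspace_continuousP pic piX Yc cover Xs ret x Zx.
have Xpi y : Z y -> X (pi y) by move=> Zy; apply: piX; exists y.
have [j _ Yj] := cover _ (Xpi _ Zx).
(* As [Y] is closed, a shift of [pi x] outside [Y] stays outside nearby; the cover leaves only [P]
   shifts to control. *)
have near_ret (i : 'I_P) : \forall w \near pi x,
    Y (shiftz (i%:Z + j%:Z) w) -> Y (shiftz (i%:Z + j%:Z) (pi x)).
  have [Yx|nYx] := pselect (Y (shiftz (i%:Z + j%:Z) (pi x))).
    exact: filterS (near_agree (pi x) 0).
  have : nbhs (pi x) (~` [set w | Y (shiftz (i%:Z + j%:Z) w)]).
    apply: open_nbhs_nbhs; split=> //; rewrite openC.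
    exact: closed_shiftz.
  by apply: filterS => w.
pose U := [set y | Z y -> forall i : 'I_P,
  Y (shiftz (i%:Z + j%:Z) (pi y)) -> Y (shiftz (i%:Z + j%:Z) (pi x))].
have /nbhs_agree[r xr] : nbhs x U.
  exact: (pic x Zx _ (filter_forall _ near_ret)).
exists r => y Zy xy.
have {xr} near_y := xr y xy Zy.
(* The cover puts the shift of [pi y] by some [i + j] in [Y], and [near_y] does the same for [pi x].
   For [pi x], moving back by [i] stays in [Y], so by [ret] it does for [pi y]. *)
have Yjy : Y (shiftz j%:Z (pi y)).
  have [i iP Yijy] := cover _ (Xs j%:Z _ (Xpi _ Zy)).
  have := Yijy; rewrite shiftzD => /(near_y (Ordinal iP)).
  rewrite -shiftzD => Yijx.
  rewrite -[X in Y X](shiftzK i%:Z); apply: ret Yijx _ Yijy.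
  by rewrite shiftzK.
have transfer u v i : Y (shiftz j%:Z u) -> Y (shiftz j%:Z v) ->
    Y (shiftz i u) -> Y (shiftz i v).
  move=> Yu Yv; have := ret (i - j%:Z) _ _ Yu _ Yv.
  by rewrite !shiftzD subrK.
by move=> i; split; exact: transfer.
Qed.

Theorem corollary25 (theta tau : directive_sequence) (q q' : nat -> nat)
  (theta_tf : torsion_free theta q) (tau_tf : torsion_free tau q')
  (theta_bd : bounded_alphabets theta) (tau_bd : bounded_alphabets tau)
  (hp : exists p : nat, prime p /\
          (exists n, (p %| q n)%N) /\ (forall n, ~~ (p %| q' n)%N)) :
  ~ topological_factor
      (level_shift theta 0) (@left_shift (alphabet theta 0))
      (level_shift tau 0) (@left_shift (alphabet tau 0)).
Proof.
move=> [pi [pic piX pi_shift]].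
have [p [pp [pq npq']]] := hp; have [C Cbd] := tau_bd.
(* The exponent is the bound [C] on the alphabets of [tau], since [p ^ C > C]. *)
have [Y [P [Yc cover ret div]]] := return_set C theta_tf theta_bd pp pq.
pose E x y := forall i, Y (shiftz i (pi x)) <-> Y (shiftz i (pi y)).
have [cl _ mini _ _] := tau_tf.
have [r rE] : exists r, forall x y,
    level_shift tau 0 x -> level_shift tau 0 y -> agree r x y -> E x y.
  apply: uniform_radius.
  - by have [] := mini 0%N.
  - by move=> x y xy i; rewrite xy.
  - by move=> x y z xy yz i; rewrite xy yz.
  apply: return_class_locally_constant pic _ Yc cover _ ret => //.
    by rewrite piX.
  by move=> k x; exact: level_shiftz.
have [n nr] := height_unbounded (2 * r) tau_tf.
set H := height q' n in nr.
have H0 : (0 < H)%N by exact: height_gt0 tau_tf _.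
have [[y Zy] _ _ _] := mini n; have [[w _] _ _ _] := mini 0%N.
pose x := subst H (w 0) (@expand tau n) y.
have Zx : level_shift tau 0 x by exact: subst_level.
have piD (t : nat) : pi (shiftz t%:Z x) = shiftz t%:Z (pi x).
  elim: t => [|t IHt]; first by rewrite !shiftz0.
  rewrite -!iter_left_shift !iterS !iter_left_shift -IHt pi_shift //.
  exact: level_shiftz.
(* With [2 * r < H], the window of radius [r] around [t * H + r] occupies the offsets [0] to [2 * r]
   of block [t], so the letter [y t] determines it. *)
have letter_E (t t' : nat) : y t%:Z = y t'%:Z ->
    E (shiftz (t * H + r)%N%:Z x) (shiftz (t' * H + r)%N%:Z x).
  move=> ytt'; apply: rE; try exact: level_shiftz.
  have xE (s : nat) i : (`|i| <= r)%N -> shiftz (s * H + r)%N%:Z x i =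
      nth (w 0) (expand (y s%:Z)) `|(i + r%:Z)%R|%N.
    move=> ir; rewrite -(substE (P := H)) //; last by lia.
    by rewrite /x /shiftz; congr (subst _ _ _ _ _); lia.
  by move=> i ir; rewrite !xE // ytt'.
have letter_mod (t t' : nat) : y t%:Z = y t'%:Z ->
    ((p ^ C)%N%:Z %| t%:Z - t'%:Z)%Z.
  move=> /letter_E tt'; have /cover[i _] : level_shift theta 0
      (shiftz (t * H + r)%N%:Z (pi x)).
    by apply: level_shiftz; rewrite -piX; exists x.
  move: (tt' i%:Z); rewrite !piD => e Yt; have Yt' := proj1 e Yt.
  (* The two positions differ by [(t - t') * H], a return time to [Y]; coprimality lets the factor
     [H] be cancelled. *)
  have cop : coprimez (p ^ C)%N%:Z H%:Z.
    rewrite /coprimez /gcdz !absz_nat; apply/eqP; congr Posz; apply/eqP.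
    rewrite -/(coprime _ _) coprimeXl // /H /height.
    elim/big_rec: _ => [|m h _ hc]; first exact: coprimen1.
    by rewrite coprimeMr prime_coprime // npq'.
  rewrite -(Gauss_dvdzl _ cop) mulrBl -!PoszM.
  apply: div Yt' _; move: Yt; rewrite !shiftzD.
  have -> : i%:Z + (t * H + r)%N%:Z =
    (t * H)%N%:Z - (t' * H)%N%:Z + i%:Z + (t' * H + r)%N%:Z by lia.
  by [].
have /leq_card : injective (fun t : 'I_(p ^ C) => y t%:Z).
  move=> t t' /letter_mod tt'; apply/ord_inj.
  move: tt' (ltn_ord t) (ltn_ord t'); rewrite dvdzE absz_nat.
  by case: (posnP `|(t%:Z - t'%:Z)%R|%N) => [|d0 /(dvdn_leq d0)]; lia.
rewrite card_ord => /leq_trans/(_ (Cbd n)).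
by rewrite leqNgt ltn_expl // prime_gt1.
Qed.
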